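(* Let $L$ be a non-negative integer, $f$ a positive integer, $s\in\{1,2,\dots,f\}$, and for non-negative integers $n_1,\dots,n_f$ put $N_i:=n_i+n_{i+1}+\dots+n_f$ for $i=1,\dots,f$, with $N_{f+1}:=0$. Then \[ \sum_{m,n,n_1,\dots,n_f\geq 0}\frac{q^{2m^2+6mn+6n^2+N_1^2+\dots+N_f^2+N_{f-s+1}+\dots+N_f}(q;q)_{2L}(q;q)_{n_f}}{(q;q)_m(q^3;q^3)_n(q;q)_{L-N_1}(q;q)_{n_f-3n-2m}(q;q)_{n_1}\cdots(q;q)_{n_{f-1}}(q;q)_{2n_f}}=\sum_{j=-L}^{L}\left(\frac{j+1}{3}\right)q^{(f+1)j^2-sj}{2L\brack L-j}_q. \]
   Context: $(a;p)_n=\prod_{k=0}^{n-1}(1-ap^k)$ for a base $p$. By convention $1/(q;q)_n=0$ for negative integers $n$, so summands with a negative index in a denominator vanish. The $q$-binomial coefficient is ${m+n\brack m}_q=\frac{(q;q)_{m+n}}{(q;q)_m(q;q)_n}$ for $m,n\ge0$ and $0$ otherwise. $\left(\frac{a}{3}\right)$ denotes the Jacobi symbol modulo 3: $0$ if $3\mid a$, $1$ if $a\equiv1\pmod 3$, $-1$ if $a\equiv 2\pmod 3$. *)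

(* Defs.v *)
From HB Require Import structures.
From mathcomp Require Import all_boot all_order all_algebra.
From mathcomp Require Import boolp classical_sets functions cardinality fsbigop.
From mathcomp Require Import zify.

Set Implicit Arguments.
Unset Strict Implicit.
Unset Printing Implicit Defensive.

Import Order.TTheory GRing.Theory Num.Theory.

Local Open Scope classical_set_scope.
Local Open Scope ring_scope.

(* (a; p)_n *)
Definition qpoch (F : fieldType) (a p : F) (n : nat) : F :=
  \prod_(k < n) (1 - a * p ^+ k).

(* 1 / (q; q)_n for an integer n, with the convention that it vanishes for
   negative n *)
Definition inv_qpoch (F : fieldType) (q : F) (n : int) : F :=
  if n is Posz k then (qpoch q q k)^-1 else 0.

(* The q-binomial coefficient with top M and bottom k *)
Definition qbinom (F : fieldType) (q : F) (M k : int) : F :=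
  match k, M - k with
  | Posz a, Posz b => qpoch q q (a + b) / (qpoch q q a * qpoch q q b)
  | _, _ => 0
  end.

(* The Jacobi symbol (a / 3) *)
Definition jacobi3 (a : int) : int :=
  if (a %% 3)%Z == 0 then 0 else if (a %% 3)%Z == 1 then 1 else -1.

(* For n = (n_1, ..., n_f), indices start at 1: [part n i] is n_i for
   1 <= i <= f. *)
Definition part (f : nat) (n : f.-tuple nat) (i : nat) : nat := nth 0%N n i.-1.

(* N_i = n_i + ... + n_f; in particular N_{f+1} = 0. *)
Definition psum (f : nat) (n : f.-tuple nat) (i : nat) : nat :=
  (\sum_(i <= k < f.+1) part n k)%N.

Definition summand (F : fieldType) (q : F) (L f s m n : nat)
    (ns : f.-tuple nat) : F :=
  q ^+ (2 * m ^ 2 + 6 * m * n + 6 * n ^ 2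
        + \sum_(1 <= i < f.+1) psum ns i ^ 2
        + \sum_(f - s + 1 <= i < f.+1) psum ns i)%N
  * qpoch q q (2 * L) * qpoch q q (part ns f)
  / (qpoch q q m * qpoch (q ^+ 3) (q ^+ 3) n)
  * inv_qpoch q (L%:Z - (psum ns 1)%:Z)
  * inv_qpoch q ((part ns f)%:Z - (3 * n)%:Z - (2 * m)%:Z)
  / ((\prod_(1 <= i < f) qpoch q q (part ns i)) * qpoch q q (2 * part ns f)).

(* The sum over all m, n, n_1, ..., n_f >= 0 has finitely many nonzero terms,
   so the finitely supported big operator computes its actual value. *)
Lemma finite_summand (F : fieldType) (q : F) (L f s : nat) : (0 < f)%N ->
  finite_set [set x : nat * nat * f.-tuple nat |
    summand q L s x.1.1 x.1.2 x.2 <> 0].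
Proof.
move=> f0.
pose g (y : 'I_L.+1 * 'I_L.+1 * {ffun 'I_f -> 'I_L.+1}) :
    nat * nat * f.-tuple nat :=
  (y.1.1 : nat, y.1.2 : nat, [tuple (y.2 i : nat) | i < f]).
apply: (@sub_finite_set _ _ (range g)); last first.
  exact/finite_image/finite_finset.
move=> [[m n] ns] /= nz.
have hN : (psum ns 1 <= L)%N.
  rewrite leqNgt; apply/negP => h; apply: nz; rewrite /summand.
  have -> : inv_qpoch q (L%:Z - (psum ns 1)%:Z) = 0.
    rewrite /inv_qpoch; case E: (_ - _)%R => [k|k] //; lia.
  by rewrite mulr0 !mul0r.
have hf : (3 * n + 2 * m <= part ns f)%N.
  rewrite leqNgt; apply/negP => h; apply: nz; rewrite /summand.
  have -> : inv_qpoch q ((part ns f)%:Z - (3 * n)%:Z - (2 * m)%:Z) = 0.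
    rewrite /inv_qpoch; case E: (_ - _)%R => [k|k] //; lia.
  by rewrite mulr0 !mul0r.
have hp (i : 'I_f) : (tnth ns i <= L)%N.
  apply: leq_trans hN; rewrite /psum big_add1 /= big_mkord (bigD1 i) //=.
  by rewrite /part /= (tnth_nth 0%N) leq_addr.
have hpf : (part ns f <= L)%N.
  have hlt : (f.-1 < f)%N by rewrite prednK.
  by have := hp (Ordinal hlt); rewrite (tnth_nth 0%N).
exists (inord m, inord n, [ffun i => inord (tnth ns i)]) => //.
rewrite /g /= !inordK; try lia.
congr (_, _); apply: eq_from_tnth => i.
by rewrite tnth_mktuple ffunE inordK // ltnS.
Qed.

(* Main.v *)
Require Import Defs.
From mathcomp Require Import all_boot all_order all_algebra.
From mathcomp Require Import boolp classical_sets functions cardinality fsbigop.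
From mathcomp Require Import zify ring.

(** Write c_j = ((1 - j)/3), so that after j |-> -j the right-hand side is
  (q;q)_{2L} times altsum, the sum over j of
  c_j q^((f+1)j^2 + sj) / ((q)_{L-j} (q)_{L+j}).

  Bailey chain. The Durfee rectangle identity shows that summing
  q^(r^2) / (q)_{L-r} against altsum raises the coefficient of j^2 by one.
  With q^(r^2+r) instead, one first replaces (q)_{L+j} by (q)_{L+j+1}, which
  is allowed because c_{-1-j} = - c_j; this raises the coefficients of both
  j^2 and j. Doing the second step s times and then the first f - s times
  reduces the theorem to "f = 0":

    sum_j c_j q^(j^2) [2L, L-j]
      = sum_{m,n} q^(2m^2+6mn+6n^2) (q)_L / ((q)_m (q^3;q^3)_n (q)_{L-3n-2m}).

  For this, q-Vandermonde applied twice writes the left-hand side as (q)_L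
  times the sum over n, k, k' of c_{k'-k} q^(n^2+n(k+k')+k^2+k'^2) /
  ((q)_n (q)_k (q)_{k'} (q)_{L-n-k-k'}). Expanding 1/((q)_k (q)_{k'}) by the
  Durfee identity (k = a + m, k' = b + m) makes the exponent
  (N^2 + n^2 + a^2 + b^2)/2 with N = n + a + b + 2m, and the sum over n, a, b
  of fixed total is then a coefficient of the product of (-zyq;q)_oo over the
  cube roots of unity z, that is of (-y^3q^3;q^3)_oo. *)

Set Implicit Arguments.
Unset Strict Implicit.
Unset Printing Implicit Defensive.

Import Order.TTheory GRing.Theory Num.Theory.

Local Open Scope classical_set_scope.
Local Open Scope ring_scope.

(** * Sums over initial segments and over windows of integers *)

Section FiniteSums.

Variable V : zmodType.

Lemma sum_ord_extend (K K' : nat) (H : nat -> V) : (K <= K')%N ->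
  (forall i, (K <= i)%N -> H i = 0) ->
  \sum_(i < K') H i = \sum_(i < K) H i.
Proof.
move=> /subnKC <- Hhi; rewrite big_split_ord /= [X in _ + X]big1 ?addr0 // => i _.
exact/Hhi/leq_addr.
Qed.

(** [H] is supported in [a, K), and both index ranges cover that interval. *)
Lemma sum_ord_shift (K a : nat) (H : nat -> V) :
  (forall i, (i < a)%N -> H i = 0) -> (forall i, (K <= i)%N -> H i = 0) ->
  \sum_(i < K) H (a + i)%N = \sum_(i < K) H i.
Proof.
move=> Hlo Hhi; rewrite -(@sum_ord_extend K (a + K) H) ?leq_addl //.
by rewrite big_split_ord /= [X in _ = X + _]big1 ?add0r // => i _; exact: Hlo.
Qed.

Lemma sum_ord_mul3 (K : nat) (H : nat -> V) :
  \sum_(i < 3 * K) H i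
  = \sum_(i < K) (H (3 * i)%N + H (3 * i).+1 + H (3 * i).+2).
Proof.
elim: K => [|K IH]; first by rewrite !big_ord0.
by rewrite [RHS]big_ord_recr -IH mulnS addnC addn3 /= !big_ord_recr /= !addrA.
Qed.

(* The sum of g over the window [-K, K - 1] of integers, which is invariant
   under j |-> -1 - j. *)
Definition zsum (K : nat) (g : int -> V) : V :=
  \sum_(i < K) (g i%:Z + g (- 1 - i%:Z)).

Lemma eq_zsum (K : nat) (g h : int -> V) : g =1 h -> zsum K g = zsum K h.
Proof. by move=> e; apply: eq_bigr => i _; rewrite !e. Qed.

Lemma zsum_extend (K K' : nat) (g : int -> V) : (K <= K')%N ->
  (forall j : int, (K%:Z <= j) || (j < - K%:Z) -> g j = 0) ->
  zsum K' g = zsum K g.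
Proof.
move=> KK' g0.
apply: (@sum_ord_extend K K' (fun i => g i%:Z + g (- 1 - i%:Z)) KK') => i Ki.
by rewrite !g0 ?addr0 //; lia.
Qed.

Lemma zsum_anti (K : nat) (g : int -> V) :
  (forall j, g (- 1 - j) = - g j) -> zsum K g = 0.
Proof. by move=> ga; rewrite /zsum big1 // => i _; rewrite ga subrr. Qed.

Lemma zsum_sum (I : finType) (K : nat) (g : I -> int -> V) :
  zsum K (fun j => \sum_i g i j) = \sum_i zsum K (g i).
Proof.
by rewrite /zsum exchange_big; apply: eq_bigr => j _; rewrite -big_split.
Qed.

(** For [g] supported in [-a, b - 1], this passes from the folded window to a single sum over
    consecutive integers, as on the right-hand side of the theorem. *)
Lemma zsumE (K n a b : nat) (g : int -> V) :
  (a <= K)%N -> (b <= K)%N -> (a + b = n)%N ->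
  (forall j : int, (b%:Z <= j) || (j < - a%:Z) -> g j = 0) ->
  zsum K g = \sum_(i < n) g (i%:Z - a%:Z).
Proof.
move=> aK bK <- g0; rewrite big_split_ord /= addrC /zsum big_split; congr (_ + _).
  rewrite (@sum_ord_extend b K (fun i => g i%:Z) bK) => [|i bi].
    by apply: eq_bigr => i _; congr g; lia.
  by apply: g0; lia.
rewrite (@sum_ord_extend a K (fun i => g (- 1 - i%:Z)) aK) => [|i ai].
  rewrite (reindex_inj rev_ord_inj); apply: eq_bigr => i _ /=; congr g.
  have := ltn_ord i; lia.
by apply: g0; lia.
Qed.

End FiniteSums.

Local Arguments inv_qpoch : simpl never.
Local Arguments qbinom : simpl never.

(** * Reciprocal q-factorials at integer indices and the Durfee identity *)

Section QSeries.

Variables (F : fieldType) (q : F).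
Hypothesis q_nroot1 : forall k : nat, (0 < k)%N -> q ^+ k != 1.

Local Notation iq := (inv_qpoch q).
Local Notation poch := (qpoch q q).

Lemma qpochS (a p : F) n : qpoch a p n.+1 = qpoch a p n * (1 - a * p ^+ n).
Proof. by rewrite /qpoch big_ord_recr. Qed.

Lemma poch0 : poch 0 = 1.
Proof. by rewrite /qpoch big_ord0. Qed.

Lemma poch_neq0 n : poch n != 0.
Proof.
apply/prodf_neq0 => i _; rewrite -exprS subr_eq0 eq_sym.
exact: q_nroot1.
Qed.

Lemma iq_nat (n : nat) : iq n%:Z = (poch n)^-1.
Proof. by []. Qed.

Lemma iq_lt0 (z : int) : z < 0 -> iq z = 0.
Proof. by case: z. Qed.

Lemma iq0 : iq 0 = 1.
Proof. by rewrite iq_nat poch0 invr1. Qed.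

Lemma poch_iq n : poch n * iq n%:Z = 1.
Proof. by rewrite iq_nat divff // poch_neq0. Qed.

(** The factor [1 - q ^ z] vanishes at z = 0, exactly where the left-hand index becomes negative, so
    the recurrence needs no sign condition. *)
Lemma iq_pred (z : int) : iq (z - 1) = (1 - q ^ z) * iq z.
Proof.
case: z => [[|n]|n]; last by rewrite !iq_lt0 ?mulr0 //; lia.
  by rewrite expr0z subrr mul0r.
have -> : Posz n.+1 - 1 = n%:Z by lia.
rewrite !iq_nat qpochS -exprS -exprnP invfM mulrCA divff ?mulr1 //.
by rewrite subr_eq0 eq_sym q_nroot1.
Qed.

Lemma iq_succ (z : int) : iq z = (1 - q ^ (z + 1)) * iq (z + 1).
Proof. by rewrite -iq_pred addrK. Qed.

Lemma summand_gt_psum (L f s m n : nat) (ns : f.-tuple nat) :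
  (L < psum ns 1)%N -> summand q L s m n ns = 0.
Proof.
by move=> h; rewrite /summand (@iq_lt0 (L%:Z - _)) ?(mulr0, mul0r) //; lia.
Qed.

Lemma summand_gt_part (L f s m n : nat) (ns : f.-tuple nat) :
  (part ns f < 3 * n + 2 * m)%N -> summand q L s m n ns = 0.
Proof.
move=> h; rewrite /summand (@iq_lt0 (_ - _ - _)) ?(mulr0, mul0r) //; lia.
Qed.

Lemma qbinomE (M : nat) (k : int) :
  qbinom q M%:Z k = poch M * iq k * iq (M%:Z - k).
Proof.
rewrite /qbinom; case: k => [a|a]; last by rewrite mulr0 mul0r.
case E : (M%:Z - a%:Z) => [b|b]; last by rewrite mulr0.
have -> : M = (a + b)%N by lia.
by rewrite !iq_nat invfM mulrA.
Qed.

Hypothesis q_neq0 : q != 0.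

Lemma qD (a b : int) : q ^ a * q ^ b = q ^ (a + b).
Proof. by rewrite expfzDr. Qed.

(* Durfee rectangle identity: the limiting case of q-Vandermonde. *)
Lemma durfee (K : nat) (k k' : int) : (k < K%:Z) ->
  \sum_(m < K) q ^ ((k - m%:Z) * (k' - m%:Z))
    * iq m%:Z * iq (k - m%:Z) * iq (k' - m%:Z) = iq k * iq k'.
Proof.
case: k => [k|k]; last first.
  move=> _; rewrite iq_lt0 ?mul0r // big1 // => m _.
  by rewrite (@iq_lt0 (Negz k - _)) ?mulr0 ?mul0r //; lia.
elim: k K => [|k IH] [|K] // kK.
  rewrite big_ord_recl big1 ?addr0 => [|m _].
    by rewrite (_ : Posz (nat_of_ord ord0) = 0) // mul0r expr0z !iq0 !mul1r.
  by rewrite (@iq_lt0 (0%:Z - _)) ?mulr0 ?mul0r //= /bump; lia.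
have q1 : 1 - q ^ (k.+1)%:Z != 0.
  by rewrite subr_eq0 eq_sym -exprnP q_nroot1.
apply: (mulfI q1); rewrite mulrA -iq_pred.
have -> : k.+1%:Z - 1 = k%:Z by lia.
rewrite -(IH K) ?mulr_sumr; last by lia.
pose t (m : nat) := q ^ ((k%:Z - m%:Z) * (k' - m%:Z))
    * iq m%:Z * iq (k%:Z - m%:Z) * iq (k' - m%:Z).
(* With a = k + 1 - m, write 1 - q^(k+1) = (1 - q^a) + q^a (1 - q^m). The first part lowers the
   index k + 1 - m by one, the second lowers the index m. *)
transitivity (\sum_(m < K.+1) q ^ (k' - m%:Z) * t m
   + \sum_(m < K.+1) q ^ (k.+1%:Z - m%:Z + (k.+1%:Z - m%:Z) * (k' - m%:Z))
    * iq (m%:Z - 1) * iq (k.+1%:Z - m%:Z) * iq (k' - m%:Z)).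
  rewrite -big_split; apply: eq_bigr => m _ /=; rewrite /t.
  have -> : k%:Z - m%:Z = (k.+1%:Z - m%:Z) - 1 by lia.
  rewrite !iq_pred.
  set a := _ - _ :> int; set b := _ - _ :> int.
  have -> : q ^ ((a - 1) * b) = q ^ (a * b) * q ^ (- b).
    by rewrite qD; congr (q ^ _); ring.
  have -> : q ^ (- b) = (q ^ b)^-1 by rewrite invr_expz.
  have -> : q ^ k.+1%:Z = q ^ a * q ^ m%:Z by rewrite qD; congr (q ^ _); lia.
  rewrite -qD; field.
  by rewrite expfz_neq0.
rewrite big_ord_recr [X in _ + X + _](_ : _ = 0) ?addr0; last first.
  by rewrite /t (@iq_lt0 (k%:Z - _)) ?(mulr0, mul0r) //=; lia.
rewrite [X in _ + X]big_ord_recl /= [X in _ + (X + _)](_ : _ = 0) ?add0r; last first.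
  by rewrite (@iq_lt0 (0%:Z - 1)) ?(mulr0, mul0r).
(* After m is shifted in the second sum, the two weights of [t m] are q^b and 1 - q^b with b = k' -
   m, and they add up to 1. *)
rewrite -big_split; apply: eq_bigr => m _ /=; rewrite /t /bump leq0n.
rewrite -[(_ + m)%N]/m.+1.
have -> : m.+1%:Z - 1 = m%:Z by lia.
have -> : k.+1%:Z - m.+1%:Z = k%:Z - m%:Z by lia.
have -> : k' - m.+1%:Z = k' - m%:Z - 1 by lia.
rewrite iq_pred; set a := k%:Z - m%:Z; set b := k' - m%:Z.
have -> : a + a * (b - 1) = a * b by ring.
ring.
Qed.

(** By the symmetry in [k] and [k'], it is enough to truncate beyond the smaller one. [bailey_step]
    relies on this because the sign of [j] is arbitrary there. *)
Lemma durfee_min (K : nat) (k k' : int) : (k < K%:Z) || (k' < K%:Z) ->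
  \sum_(m < K) q ^ ((k - m%:Z) * (k' - m%:Z))
    * iq m%:Z * iq (k - m%:Z) * iq (k' - m%:Z) = iq k * iq k'.
Proof.
case/orP => h; first exact: durfee.
rewrite mulrC -(durfee _ h); apply: eq_bigr => m _.
by rewrite [X in q ^ X]mulrC; ring.
Qed.

(** * The character modulo 3 and the Bailey steps *)

Definition chi (j : int) : F := (jacobi3 (1 - j))%:~R.

Lemma chi0 : chi 0 = 1.
Proof. by []. Qed.

(** The symbol is odd, and 2 + j is congruent to -(1 - j) modulo 3. *)
Lemma chi_anti (j : int) : chi (- 1 - j) = - chi j.
Proof.
rewrite /chi -mulrNz; congr (_%:~R); rewrite /jacobi3.
do !case: eqP; lia.
Qed.

Lemma chi_sum3 (j : int) : chi j + chi (j + 1) + chi (j - 1) = 0.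
Proof.
rewrite /chi -!intrD (_ : _ + _ = 0) //; rewrite /jacobi3.
do !case: eqP; lia.
Qed.

(** Since r^2 + e r = j^2 + e j + (r - j)(r + j + e), putting r = L - m gives the Durfee sum for L -
    j and L + j + e. The flag [e] selects the weight q^(r^2+r) instead of q^(r^2). *)
Lemma bailey_step (L : nat) (e : bool) (j : int) :
  \sum_(r < L.+1) q ^ (r%:Z * r%:Z + e%:Z * r%:Z) * iq (L%:Z - r%:Z)
     * iq (r%:Z - j) * iq (r%:Z + j + e%:Z)
  = q ^ (j * j + e%:Z * j) * iq (L%:Z - j) * iq (L%:Z + j + e%:Z).
Proof.
rewrite -mulrA -(@durfee_min L.+1); last by case: e; lia.
rewrite mulr_sumr (reindex_inj rev_ord_inj); apply: eq_bigr => m _ /=.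
have mL := ltn_ord m; rewrite !mulrA qD subSS.
have -> : (L - m)%N%:Z = L%:Z - m%:Z by lia.
have -> : L%:Z - (L%:Z - m%:Z) = m%:Z by lia.
congr (q ^ _ * _ * iq _ * iq _); lia.
Qed.

(* (q;q)_{2L} times this is the alternating sum over j on the right-hand side
   of the theorem, after j |-> -j. *)
Definition altsum (A B : int) (L : nat) : F :=
  zsum L.+1 (fun j => chi j * q ^ (A * (j * j) + B * j)
                      * iq (L%:Z - j) * iq (L%:Z + j)).

Lemma altsum_widen (A B : int) (L K : nat) : (L < K)%N ->
  altsum A B L = zsum K (fun j => chi j * q ^ (A * (j * j) + B * j)
                                  * iq (L%:Z - j) * iq (L%:Z + j)).
Proof.
move=> LK; rewrite (zsum_extend LK) // => j /orP[h|h].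
  by rewrite (@iq_lt0 (_ - _)) ?mulr0 ?mul0r //; lia.
by rewrite (@iq_lt0 (L%:Z + j)) ?mulr0 ?mul0r //; lia.
Qed.

Lemma zsum_bailey (K L : nat) (e : bool) (A B : int) :
  \sum_(r < L.+1) q ^ (r%:Z * r%:Z + e%:Z * r%:Z) * iq (L%:Z - r%:Z)
    * zsum K (fun j => chi j * q ^ (A * (j * j) + B * j)
                       * iq (r%:Z - j) * iq (r%:Z + j + e%:Z))
  = zsum K (fun j => chi j * q ^ ((A + 1) * (j * j) + (B + e%:Z) * j)
                     * iq (L%:Z - j) * iq (L%:Z + j + e%:Z)).
Proof.
transitivity (\sum_(r < L.+1) zsum K (fun j =>
   chi j * q ^ (A * (j * j) + B * j) *
   (q ^ (r%:Z * r%:Z + e%:Z * r%:Z) * iq (L%:Z - r%:Z)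
     * iq (r%:Z - j) * iq (r%:Z + j + e%:Z)))).
  apply: eq_bigr => r _; rewrite /zsum mulr_sumr; apply: eq_bigr => i _; ring.
rewrite -zsum_sum; apply: eq_zsum => j; rewrite -mulr_sumr bailey_step.
have -> : (A + 1) * (j * j) + (B + e%:Z) * j
  = (A * (j * j) + B * j) + (j * j + e%:Z * j) by ring.
by rewrite -[in RHS]qD; ring.
Qed.

Lemma altsum_step (A B : int) (L : nat) :
  \sum_(r < L.+1) q ^ (r%:Z * r%:Z) * iq (L%:Z - r%:Z) * altsum A B r
  = altsum (A + 1) B L.
Proof.
have := zsum_bailey L.+1 L false A B.
rewrite (_ : (false : nat)%:Z = 0) // addr0.
under eq_zsum do rewrite addr0.
under eq_bigr do (rewrite mul0r addr0; under eq_zsum do rewrite addr0).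
rewrite -/(altsum (A + 1) B L) => <-; apply: eq_bigr => r _.
by rewrite (altsum_widen _ _ (ltn_ord r)).
Qed.

(* The two sides differ by a sum whose terms are odd under j |-> -1 - j. *)
Lemma altsum_shift (A : int) (L K : nat) : (L < K)%N ->
  altsum A (A - 1) L
  = zsum K (fun j => chi j * q ^ (A * (j * j) + (A - 1) * j)
                     * iq (L%:Z - j) * iq (L%:Z + j + 1)).
Proof.
move=> LK; rewrite (altsum_widen _ _ LK); apply/eqP; rewrite -subr_eq0; apply/eqP.
rewrite /zsum -sumrB.
(* Expanding 1/(q)_{L+j} leaves a term with the extra factor q^(L+j+1). The choice B = A - 1 makes
   its exponent A(j^2 + j) + L + 1 invariant under j |-> -1 - j, which also swaps the two [iq]
   factors. *)
pose g j := - (chi j * q ^ (A * (j * j + j) + L%:Z + 1)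
               * iq (L%:Z - j) * iq (L%:Z + j + 1)).
rewrite -[RHS](@zsum_anti _ K g); last first.
  move=> j; rewrite /g chi_anti -!mulNr mulrAC; congr (- _ * q ^ _ * iq _ * iq _);
    ring.
have e j : chi j * q ^ (A * (j * j) + (A - 1) * j) * iq (L%:Z - j) * iq (L%:Z + j)
  - chi j * q ^ (A * (j * j) + (A - 1) * j) * iq (L%:Z - j) * iq (L%:Z + j + 1)
  = g j.
  rewrite (iq_succ (L%:Z + j)) /g.
  have -> : A * (j * j + j) + L%:Z + 1
     = (A * (j * j) + (A - 1) * j) + (L%:Z + j + 1) by ring.
  by set x := A * (j * j) + _; rewrite -(qD x); ring.
by apply: eq_bigr => i _; rewrite -!e; ring.
Qed.

(** [altsum_shift] is used at both ends. The result again has linear coefficient one below the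
    quadratic one, so the step can be repeated. *)
Lemma altsum_stepq (A : int) (L : nat) :
  \sum_(r < L.+1) q ^ (r%:Z * r%:Z + r%:Z) * iq (L%:Z - r%:Z) * altsum A (A - 1) r
  = altsum (A + 1) A L.
Proof.
have -> : altsum (A + 1) A L = altsum (A + 1) (A + 1 - 1) L by rewrite addrK.
rewrite (altsum_shift _ (ltnSn L)).
have := zsum_bailey L.+1 L true A (A - 1); rewrite addrAC => <-.
apply: eq_bigr => r _; rewrite mul1r; congr (_ * _).
exact: altsum_shift.
Qed.

(** * q-binomial coefficients and multisum forms of the base case *)

Definition qbin (n : nat) (w : int) : F := poch n * iq w * iq (n%:Z - w).

Lemma qbin_sym (n : nat) (w : int) : qbin n (n%:Z - w) = qbin n w.
Proof. by rewrite /qbin subKr mulrAC. Qed.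

Lemma qbin_lt0 (n : nat) (w : int) : w < 0 -> qbin n w = 0.
Proof. by move=> w0; rewrite /qbin (iq_lt0 w0) mulr0 mul0r. Qed.

Lemma qbin_gt (n : nat) (w : int) : n%:Z < w -> qbin n w = 0.
Proof. by move=> w0; rewrite /qbin (@iq_lt0 (_ - _)) ?mulr0 //; lia. Qed.

Lemma qbin_pascal (n : nat) (w : int) :
  qbin n.+1 w = qbin n w + q ^ (n.+1%:Z - w) * qbin n (w - 1).
Proof.
rewrite /qbin qpochS -exprS.
have -> : n%:Z - w = n.+1%:Z - w - 1 by lia.
have -> : n%:Z - (w - 1) = n.+1%:Z - w by lia.
rewrite !iq_pred (_ : q ^+ n.+1 = q ^ (n.+1%:Z - w) * q ^ w); first by ring.
by rewrite qD exprnP; congr (q ^ _); lia.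
Qed.

(** Induction on [U]: [qbin_pascal], applied to the top [U.+1] and to the total, produces the
    instances at [w] and [w - 1] on both sides. *)
Lemma qbin_vandermonde (U V K : nat) (w : int) : (U < K)%N ->
  \sum_(k < K) q ^ (k%:Z * (V%:Z - w + k%:Z)) * qbin U k%:Z * qbin V (w - k%:Z)
  = qbin (U + V) w.
Proof.
elim: U K w => [|U IH] [|K] w // UK.
  rewrite big_ord_recl big1 ?addr0 => [|k _].
    rewrite (_ : Posz (nat_of_ord ord0) = 0) // mul0r expr0z /qbin.
    by rewrite !subr0 poch0 !iq0 !mul1r.
  by rewrite qbin_gt ?mulr0 ?mul0r //= /bump; lia.
rewrite addSn qbin_pascal -(IH K.+1 w); last by lia.
rewrite -(IH K (w - 1)) // mulr_sumr.
under eq_bigr do rewrite qbin_pascal mulrDr mulrDl.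
rewrite big_split; congr (_ + _) => /=.
rewrite big_ord_recl (@qbin_lt0 U) // !(mulr0, mul0r) add0r.
apply: eq_bigr => k _ /=; rewrite /bump leq0n -[(true + k)%N]/k.+1.
have -> : k.+1%:Z - 1 = k%:Z by lia.
have -> : w - k.+1%:Z = w - 1 - k%:Z by lia.
rewrite -[in LHS]mulrA -[in RHS]mulrA -[in LHS]mulrA.
rewrite [LHS]mulrA [RHS]mulrA !qD; congr (q ^ _ * _); lia.
Qed.

Lemma qbin_square_sum (L : nat) (j : int) :
  qbin (L + L) (L%:Z - j)
  = \sum_(k < L.+1) q ^ (k%:Z * (k%:Z + j)) * qbin L k%:Z * qbin L (k%:Z + j).
Proof.
rewrite -(@qbin_vandermonde L L L.+1) //; apply: eq_bigr => k _.
rewrite -[qbin L (_ - _)]qbin_sym; congr (q ^ _ * _ * qbin _ _); lia.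
Qed.

Lemma altsum_qbin2 (L : nat) :
  poch (2 * L) * altsum 1 0 L
  = \sum_(U < L.+1) \sum_(V < L.+1) chi (V%:Z - U%:Z)
      * q ^ ((V%:Z - U%:Z) * (V%:Z - U%:Z) + U%:Z * V%:Z)
      * qbin L U%:Z * qbin L V%:Z.
Proof.
transitivity (zsum L.+1 (fun j => \sum_(U < L.+1) chi j
      * q ^ (j * j + U%:Z * (U%:Z + j)) * qbin L U%:Z * qbin L (U%:Z + j))).
  rewrite /altsum {1}/zsum mulr_sumr -/(zsum L.+1 _).
  have e j : poch (2 * L) * (chi j * q ^ (1 * (j * j) + 0 * j)
      * iq (L%:Z - j) * iq (L%:Z + j))
    = \sum_(U < L.+1) chi j
      * q ^ (j * j + U%:Z * (U%:Z + j)) * qbin L U%:Z * qbin L (U%:Z + j).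
    transitivity (chi j * q ^ (j * j) * qbin (L + L) (L%:Z - j)).
      rewrite /qbin mul1r mul0r addr0 addnn -mul2n.
      have -> : (2 * L)%N%:Z - (L%:Z - j) = L%:Z + j by lia.
      ring.
    rewrite qbin_square_sum mulr_sumr; apply: eq_bigr => U _.
    by rewrite -qD; ring.
  by apply: eq_bigr => i _; rewrite -!e; ring.
rewrite zsum_sum; apply: eq_bigr => U _; have UL := ltn_ord U.
(* For fixed U the support is -U <= j <= L - U, that is, j = V - U with 0 <= V <= L. *)
rewrite (@zsumE _ L.+1 L.+1 U (L.+1 - U)); try lia; last first.
  move=> j h; have [h1|h1] := ltP (U%:Z + j) 0.
    by rewrite (qbin_lt0 _ h1) mulr0.
  by rewrite (@qbin_gt L (_ + j)) ?mulr0 //; lia.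
by apply: eq_bigr => V _; rewrite (_ : U%:Z + (V%:Z - U%:Z) = V%:Z) //; lia.
Qed.

Definition triple_term (L : nat) (n k k' : int) : F :=
  chi (k' - k) * q ^ (n * n + n * (k + k') + k * k + k' * k')
  * iq n * iq k * iq k' * iq (L%:Z - n - k - k').

(** Here [L, V] is expanded by q-Vandermonde with tops U and L - U, whose q-factorials cancel the
    denominators of [L, U]. The new variables satisfy U = n + k and V = n + k'. *)
Lemma altsum_triple (L : nat) :
  poch (2 * L) * altsum 1 0 L
  = poch L * \sum_(k < L.+1) \sum_(n < L.+1) \sum_(k' < L.+1)
      triple_term L n%:Z k%:Z k'%:Z.
Proof.
pose T (k U V : nat) := triple_term L (U%:Z - k%:Z) k%:Z (V%:Z - U%:Z + k%:Z).
transitivity (poch L * \sum_(k < L.+1) \sum_(U < L.+1) \sum_(V < L.+1) T k U V).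
  rewrite altsum_qbin2 [in RHS]exchange_big mulr_sumr; apply: eq_bigr => U _.
  rewrite exchange_big mulr_sumr; apply: eq_bigr => V _; have UL := ltn_ord U.
  rewrite -[qbin L V%:Z]qbin_sym.
  have := @qbin_vandermonde U (L - U) L.+1 (L%:Z - V%:Z) UL.
  rewrite subnKC // => <-; rewrite !mulr_sumr.
  apply: eq_bigr => k _; rewrite /T /triple_term /qbin.
  have -> : (L - U)%N%:Z = L%:Z - U%:Z by lia.
  have -> : L%:Z - U%:Z - (L%:Z - V%:Z - k%:Z) = V%:Z - U%:Z + k%:Z by ring.
  have -> : L%:Z - (U%:Z - k%:Z) - k%:Z - (V%:Z - U%:Z + k%:Z)
     = L%:Z - V%:Z - k%:Z by ring.
  have -> : V%:Z - U%:Z + k%:Z - k%:Z = V%:Z - U%:Z by ring.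
  have -> : L%:Z - U%:Z - (L%:Z - V%:Z) + k%:Z = V%:Z - U%:Z + k%:Z by ring.
  set x := (U%:Z - k%:Z) * _ + _ + _ + _.
  have -> : x = ((V%:Z - U%:Z) * (V%:Z - U%:Z) + U%:Z * V%:Z)
     + (k%:Z * (V%:Z - U%:Z + k%:Z)) by rewrite /x; ring.
  rewrite -!qD.
  have e1 := poch_iq U; have := poch_iq (L - U).
  have -> : (L - U)%N%:Z = L%:Z - U%:Z by lia.
  move=> e2.
  have cancel y : y = poch U * iq U * (poch (L - U) * iq (L%:Z - U%:Z)) * y.
    by rewrite e1 e2 !mul1r.
  by rewrite [RHS]cancel; ring.
congr (_ * _); apply: eq_bigr => k _; have kL := ltn_ord k.
rewrite -(@sum_ord_shift _ L.+1 k (fun U => \sum_(V < L.+1) T k U V)); first last.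
- move=> U UL; rewrite big1 // => V _; rewrite /T /triple_term.
  have [VL|VL] := ltP (L%:Z - V%:Z - k%:Z) 0.
    by rewrite (@iq_lt0 (L%:Z - _ - _ - _)) ?mulr0 //; lia.
  by rewrite (@iq_lt0 (V%:Z - U%:Z + k%:Z)) ?(mulr0, mul0r) //; lia.
- move=> U Uk; rewrite big1 // => V _; rewrite /T /triple_term.
  by rewrite (@iq_lt0 (U%:Z - k%:Z)) ?(mulr0, mul0r) //; lia.
apply: eq_bigr => n _.
rewrite -(@sum_ord_shift _ L.+1 n (fun V => T k (k + n)%N V)); first last.
- move=> V VL; rewrite /T /triple_term.
  by rewrite (@iq_lt0 (L%:Z - _ - _ - _)) ?mulr0 //; lia.
- move=> V Vn; rewrite /T /triple_term.
  by rewrite (@iq_lt0 (V%:Z - (k + n)%N%:Z + k%:Z)) ?(mulr0, mul0r) //; lia.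
by apply: eq_bigr => k' _; congr triple_term; lia.
Qed.

(** With k = a + m and k' = b + m, the Durfee exponent becomes a b and the character still depends
    on b - a only. *)
Lemma triple_sum_durfee (L : nat) :
  \sum_(k < L.+1) \sum_(n < L.+1) \sum_(k' < L.+1) triple_term L n%:Z k%:Z k'%:Z
  = \sum_(m < L.+1) iq m%:Z *
      \sum_(a < L.+1) \sum_(b < L.+1) \sum_(n < L.+1)
        chi (b%:Z - a%:Z)
        * q ^ (n%:Z * n%:Z + n%:Z * (a%:Z + b%:Z + 2 * m%:Z)
           + (a%:Z + m%:Z) * (a%:Z + m%:Z) + (b%:Z + m%:Z) * (b%:Z + m%:Z)
           + a%:Z * b%:Z)
        * iq n%:Z * iq a%:Z * iq b%:Z * iq (L%:Z - 2 * m%:Z - (n + a + b)%N%:Z).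
Proof.
pose T (m n k k' : nat) := chi (k'%:Z - k%:Z)
  * q ^ (n%:Z * n%:Z + n%:Z * (k%:Z + k'%:Z) + k%:Z * k%:Z + k'%:Z * k'%:Z
         + (k%:Z - m%:Z) * (k'%:Z - m%:Z))
  * iq n%:Z * iq m%:Z * iq (k%:Z - m%:Z) * iq (k'%:Z - m%:Z)
  * iq (L%:Z - n%:Z - k%:Z - k'%:Z).
transitivity (\sum_(m < L.+1) \sum_(k < L.+1) \sum_(k' < L.+1) \sum_(n < L.+1)
    T m n k k').
  rewrite [RHS]exchange_big; apply: eq_bigr => k _.
  rewrite exchange_big [RHS]exchange_big; apply: eq_bigr => k' _.
  rewrite [RHS]exchange_big; apply: eq_bigr => n _.
  have kL : (k%:Z < L.+1%:Z) by have := ltn_ord k; lia.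
  transitivity (chi (k'%:Z - k%:Z)
    * q ^ (n%:Z * n%:Z + n%:Z * (k%:Z + k'%:Z) + k%:Z * k%:Z + k'%:Z * k'%:Z)
    * iq n%:Z * iq (L%:Z - n%:Z - k%:Z - k'%:Z) * (iq k%:Z * iq k'%:Z)).
    by rewrite /triple_term; ring.
  rewrite -(durfee k'%:Z kL) mulr_sumr; apply: eq_bigr => m _; rewrite /T.
  by set x := _ + k'%:Z * k'%:Z; rewrite -(qD x); ring.
apply: eq_bigr => m _; rewrite mulr_sumr.
rewrite -(@sum_ord_shift _ L.+1 m
  (fun k => \sum_(k' < L.+1) \sum_(n < L.+1) T m n k k')); first last.
- move=> k kL; rewrite big1 // => k' _; rewrite big1 // => n _.
  by rewrite /T (@iq_lt0 (_ - k'%:Z)) ?mulr0 //; lia.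
- move=> k km; rewrite big1 // => k' _; rewrite big1 // => n _.
  by rewrite /T (@iq_lt0 (k%:Z - _)) ?(mulr0, mul0r) //; lia.
apply: eq_bigr => a _; rewrite mulr_sumr.
rewrite -(@sum_ord_shift _ L.+1 m
  (fun k' => \sum_(n < L.+1) T m n (m + a)%N k')); first last.
- move=> k' kL; rewrite big1 // => n _.
  by rewrite /T (@iq_lt0 (_ - k'%:Z)) ?mulr0 //; lia.
- move=> k' km; rewrite big1 // => n _.
  by rewrite /T (@iq_lt0 (k'%:Z - m%:Z)) ?(mulr0, mul0r) //; lia.
apply: eq_bigr => b _; rewrite mulr_sumr; apply: eq_bigr => n _; rewrite /T.
have -> : (m + a)%N%:Z - m%:Z = a%:Z by lia.
have -> : (m + b)%N%:Z - m%:Z = b%:Z by lia.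
have -> : (m + b)%N%:Z - (m + a)%N%:Z = b%:Z - a%:Z by lia.
have -> : L%:Z - n%:Z - (m + a)%N%:Z - (m + b)%N%:Z
  = L%:Z - 2 * m%:Z - (n + a + b)%N%:Z by lia.
set x := (X in q ^ X); set y := (X in _ = _ * (_ * q ^ X * _ * _ * _ * _)).
have -> : x = y by rewrite /x /y !PoszD; ring.
ring.
Qed.

(** * Generating functions over the cube roots of unity *)

(* Coefficients of (-yq;q)_oo = \sum_z qexp z y^z. *)
Definition qexp (z : int) : F :=
  if z is Posz n then q ^ 'C(n.+1, 2)%:Z * iq z else 0.

Arguments qexp : simpl never.

Lemma qexp_lt0 (z : int) : z < 0 -> qexp z = 0.
Proof. by case: z. Qed.

(** This is E(y) = (1 + yq) E(yq) for E(y) = (-yq;q)_oo, read off coefficientwise. *)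
Lemma qexp_rec (z : int) : qexp z = q ^ z * (qexp z + qexp (z - 1)).
Proof.
case: z => [[|n]|n]; last by rewrite !qexp_lt0 ?addr0 ?mulr0 //; lia.
  by rewrite expr0z mul1r (@qexp_lt0 (_ - 1)) ?addr0.
have -> : Posz n.+1 - 1 = n%:Z by lia.
rewrite /qexp (iq_succ n%:Z) binS bin1 PoszD -qD.
have -> : n%:Z + 1 = n.+1%:Z by lia.
ring.
Qed.

(* Coefficients of the product of the series (-zyq;q)_oo over the three cube
   roots of unity z, which is (-y^3q^3;q^3)_oo. *)
Definition cube_coef (K : nat) (M : int) : F :=
  \sum_(a < K) \sum_(b < K) chi (b%:Z - a%:Z)
    * qexp a%:Z * qexp b%:Z * qexp (M - a%:Z - b%:Z).

Lemma sum_qexp_pred (K : nat) (g : nat -> F) : g K = 0 ->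
  \sum_(a < K) (qexp a%:Z + qexp (a%:Z - 1)) * g a
  = \sum_(a < K) qexp a%:Z * (g a + g a.+1).
Proof.
move=> gK; under eq_bigr do rewrite mulrDl; under [RHS]eq_bigr do rewrite mulrDr.
rewrite !big_split; congr (_ + _) => /=.
case: K gK => [|K] gK; first by rewrite !big_ord0.
rewrite big_ord_recl (@qexp_lt0 (_ - 1)) // mul0r add0r.
rewrite [RHS]big_ord_recr [X in _ = _ + X](_ : _ = 0) ?addr0; last first.
  by rewrite /= gK mulr0.
apply: eq_bigr => a _.
by rewrite lift0 /=; congr (qexp _ * _); lia.
Qed.

(** This is P(y) = (1 + y^3 q^3) P(yq) for P(y) = (-y^3q^3;q^3)_oo, read off coefficientwise. The
    bound on [M] ensures that the cutoff [K] loses no term. *)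
Lemma cube_coef_rec (K : nat) (M : int) : M < K%:Z ->
  cube_coef K M = q ^ M * (cube_coef K M + cube_coef K (M - 3)).
Proof.
move=> MK; pose X z := qexp z + qexp (z - 1).
have X0 (z : int) : z < 0 -> X z = 0.
  by move=> z0; rewrite /X !qexp_lt0 ?addr0 //; lia.
transitivity (q ^ M * \sum_(a < K) X a%:Z *
    \sum_(b < K) X b%:Z * (chi (b%:Z - a%:Z) * X (M - a%:Z - b%:Z))).
  rewrite mulr_sumr; apply: eq_bigr => a _; rewrite !mulr_sumr.
  apply: eq_bigr => b _.
  have -> : q ^ M = q ^ a%:Z * q ^ b%:Z * q ^ (M - a%:Z - b%:Z).
    by rewrite !qD; congr (q ^ _); ring.
  rewrite (qexp_rec a%:Z) (qexp_rec b%:Z) (qexp_rec (M - a%:Z - b%:Z)) /X; ring.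
congr (_ * _).
pose h (a b : nat) := chi (b%:Z - a%:Z) * X (M - a%:Z - b%:Z).
have inner (a : nat) : \sum_(b < K) X b%:Z * h a b
    = \sum_(b < K) qexp b%:Z * (h a b + h a b.+1).
  by apply: sum_qexp_pred; rewrite /h X0 ?mulr0 //; lia.
rewrite (@sum_qexp_pred K (fun a => \sum_(b < K) X b%:Z * h a b)); last first.
  by rewrite big1 // => b _; rewrite /h (X0 (M - _ - _)) ?mulr0 //; lia.
rewrite /cube_coef -big_split; apply: eq_bigr => a _ /=.
rewrite !inner -!big_split mulr_sumr; apply: eq_bigr => b _ /=.
rewrite /h.
set z := M - a%:Z - b%:Z.
have -> : M - a%:Z - b.+1%:Z = z - 1 by rewrite /z; lia.
have -> : M - a.+1%:Z - b%:Z = z - 1 by rewrite /z; lia.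
have -> : M - a.+1%:Z - b.+1%:Z = z - 2 by rewrite /z; lia.
have -> : M - 3 - a%:Z - b%:Z = z - 3 by rewrite /z; ring.
have -> : b.+1%:Z - a.+1%:Z = b%:Z - a%:Z by lia.
have -> : b.+1%:Z - a%:Z = (b%:Z - a%:Z) + 1 by lia.
have -> : b%:Z - a.+1%:Z = (b%:Z - a%:Z) - 1 by lia.
(* As c + c1 + c2 = 0, the four shifts combine to c (X(z) - X(z - 1) + X(z - 2)), which telescopes
   to c ([qexp z + qexp (z - 3)]). *)
have := chi_sum3 (b%:Z - a%:Z); set c := chi _; set c1 := chi _; set c2 := chi _.
move=> /(canRL (addrK _)); rewrite add0r => cE.
have {cE} -> : c1 = - c2 - c by rewrite -cE addrC addKr.
rewrite /X -!addrA.
have -> : - (1) - 1 = - 2 :> int by [].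
have -> : - (2) - 1 = - 3 :> int by [].
ring.
Qed.

Lemma cube_coef_lt0 (K : nat) (M : int) : M < 0 -> cube_coef K M = 0.
Proof.
move=> M0; rewrite /cube_coef big1 // => a _; rewrite big1 // => b _.
by rewrite (@qexp_lt0 (M - _ - _)) ?mulr0 //; lia.
Qed.

Lemma cube_coef0 (K : nat) : cube_coef K.+1 0 = 1.
Proof.
rewrite /cube_coef big_ord_recl [X in _ + X]big1 ?addr0; last first.
  move=> a _; rewrite big1 // => b _.
  by rewrite (@qexp_lt0 (0 - _ - _)) ?mulr0 //= /bump; lia.
rewrite big_ord_recl [X in _ + X]big1 ?addr0; last first.
  by move=> b _; rewrite (@qexp_lt0 (_ - (lift ord0 b)%:Z)) ?mulr0 //= /bump; lia.
by rewrite /= /qexp ?subrr /= expr0z iq0 chi0 !mulr1.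
Qed.

(** The recurrence links each coefficient to the one three places below, so the initial values at
    -2, -1 and 0 decide the three residue classes. *)
Lemma cube_coefE (K l : nat) :
  [/\ (3 * l < K)%N -> cube_coef K (3 * l)%N%:Z
        = q ^ (3 * 'C(l.+1, 2))%N%:Z / qpoch (q ^+ 3) (q ^+ 3) l,
      ((3 * l).+1 < K)%N -> cube_coef K (3 * l).+1%:Z = 0
    & ((3 * l).+2 < K)%N -> cube_coef K (3 * l).+2%:Z = 0].
Proof.
have rec (M : nat) (v : F) : (0 < M < K)%N -> cube_coef K (M%:Z - 3) = v ->
    cube_coef K M%:Z = q ^ M%:Z / (1 - q ^ M%:Z) * v.
  move=> /andP[M0 MK] e; have n0 : 1 - q ^ M%:Z != 0.
    by rewrite subr_eq0 eq_sym -exprnP q_nroot1.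
  apply: (mulfI n0); rewrite mulrBl mul1r {1}cube_coef_rec // e.
  by field.
elim: l => [|l [IH0 IH1 IH2]]; split.
- case: K rec => // K _ _; rewrite muln0 cube_coef0 /qpoch big_ord0.
  by rewrite expr0z divr1.
- by move=> h; rewrite (rec _ 0) ?mulr0 ?cube_coef_lt0.
- by move=> h; rewrite (rec _ 0) ?mulr0 ?cube_coef_lt0.
- move=> h; rewrite (rec _ _ _ (erefl _)); last by lia.
  have -> : (3 * l.+1)%N%:Z - 3 = (3 * l)%N%:Z by lia.
  rewrite IH0; last by lia.
  rewrite qpochS -exprS -exprM invfM (binS l.+1) bin1 mulnDr PoszD -qD -!exprnP.
  ring.
- move=> h; rewrite (rec _ 0) ?mulr0 //.
  have -> : (3 * l.+1).+1%:Z - 3 = (3 * l).+1%:Z by lia.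
  by apply: IH1; lia.
- move=> h; rewrite (rec _ 0) ?mulr0 //.
  have -> : (3 * l.+1).+2%:Z - 3 = (3 * l).+2%:Z by lia.
  by apply: IH2; lia.
Qed.

Lemma bin2_double (n : nat) : (2 * 'C(n, 2) + n = n * n)%N.
Proof. by elim: n => // n IH; rewrite binS bin1; lia. Qed.

Lemma altsum_base (L : nat) :
  poch (2 * L) * altsum 1 0 L
  = poch L * \sum_(m < L.+1) \sum_(n < L.+1)
      q ^+ (2 * m ^ 2 + 6 * m * n + 6 * n ^ 2)%N
      / (poch m * qpoch (q ^+ 3) (q ^+ 3) n)
      * iq (L%:Z - (3 * n)%N%:Z - (2 * m)%N%:Z).
Proof.
rewrite altsum_triple triple_sum_durfee; congr (_ * _); apply: eq_bigr => m _.
(* [phi] collects what depends only on the total M = n + a + b. The rest of the exponent is C(n+1,2)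
   + C(a+1,2) + C(b+1,2), as in the three [qexp] factors. *)
pose phi (M : nat) := q ^ ('C(M, 2) + 2 * m * M + 2 * m ^ 2)%N%:Z
  * iq (L%:Z - 2 * m%:Z - M%:Z).
have phi0 (M : nat) : (L < M)%N -> phi M = 0.
  by move=> LM; rewrite /phi (@iq_lt0 (_ - _)) ?mulr0 //; lia.
transitivity (iq m%:Z * \sum_(M < L.+1) phi M * cube_coef L.+1 M%:Z).
  congr (_ * _).
  transitivity (\sum_(a < L.+1) \sum_(b < L.+1) \sum_(M < L.+1)
      phi M * (chi (b%:Z - a%:Z)
      * qexp a%:Z * qexp b%:Z * qexp (M%:Z - a%:Z - b%:Z))).
    apply: eq_bigr => a _; apply: eq_bigr => b _.
    rewrite -(@sum_ord_shift _ L.+1 (a + b) (fun M => phi M * (chi (b%:Z - a%:Z)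
      * qexp a%:Z * qexp b%:Z * qexp (M%:Z - a%:Z - b%:Z)))); first last.
    + by move=> M LM; rewrite phi0 ?mul0r.
    + by move=> M Mab; rewrite (@qexp_lt0 (M%:Z - _ - _)) ?mulr0 //; lia.
    apply: eq_bigr => n _.
    have -> : (a + b + n)%N%:Z - a%:Z - b%:Z = n%:Z by lia.
    have -> : (a + b + n = n + a + b)%N by lia.
    rewrite /phi /qexp; set x := (X in q ^ X).
    set y := ('C(n + a + b, 2) + _ + _)%N.
    have -> : x = y%:Z + 'C(a.+1, 2)%:Z + 'C(b.+1, 2)%:Z + 'C(n.+1, 2)%:Z.
      rewrite /x /y !binS !bin1.
      have := bin2_double n; have := bin2_double a; have := bin2_double b.
      have := bin2_double (n + a + b); lia.
    rewrite -!qD; ring.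
  under [RHS]eq_bigr do rewrite /cube_coef mulr_sumr.
  rewrite [RHS]exchange_big; apply: eq_bigr => a _.
  under [RHS]eq_bigr do rewrite mulr_sumr.
  by rewrite [RHS]exchange_big.
(* Terms with M > L vanish, so the range may be extended to a multiple of 3 and grouped by residues;
   only M = 3n survives. *)
rewrite -(@sum_ord_extend _ L.+1 (3 * L.+1) (fun M => phi M * cube_coef L.+1 M%:Z));
  first last.
- by move=> M LM; rewrite phi0 ?mul0r.
- by lia.
rewrite (@sum_ord_mul3 _ L.+1 (fun M => phi M * cube_coef L.+1 M%:Z)) mulr_sumr; apply: eq_bigr => n _.
have [e0 e1 e2] := cube_coefE L.+1 n.
have -> : phi (3 * n).+1 * cube_coef L.+1 (3 * n).+1%:Z = 0.
  have [h|h] := ltnP (3 * n).+1 L.+1; first by rewrite e1 ?mulr0.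
  by rewrite phi0 ?mul0r.
have -> : phi (3 * n).+2 * cube_coef L.+1 (3 * n).+2%:Z = 0.
  have [h|h] := ltnP (3 * n).+2 L.+1; first by rewrite e2 ?mulr0.
  by rewrite phi0 ?mul0r.
rewrite !addr0.
have E : L%:Z - (3 * n)%N%:Z - (2 * m)%N%:Z = L%:Z - 2 * m%:Z - (3 * n)%N%:Z by lia.
have [h|h] := ltnP (3 * n) L.+1; last first.
  by rewrite phi0 // E (@iq_lt0 (_ - _)) ?(mulr0, mul0r) //; lia.
rewrite e0 // /phi E -!exprnP.
have -> : (2 * m ^ 2 + 6 * m * n + 6 * n ^ 2
  = 'C(3 * n, 2) + 2 * m * (3 * n) + 2 * m ^ 2 + 3 * 'C(n.+1, 2))%N.
  rewrite binS bin1.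
  have := bin2_double n; have := bin2_double (3 * n); lia.
set z := ('C(3 * n, 2) + _ + _)%N.
by rewrite exprD invfM iq_nat; ring.
Qed.

(** * Iterating the Bailey steps over the parts *)

Lemma altsum_chain (K L : nat) (e : bool) (A B : int) : (L < K)%N ->
  (e -> B = A - 1) ->
  \sum_(r < K) q ^+ (r ^ 2 + e * r)%N * iq (L%:Z - r%:Z) * altsum A B r
  = altsum (A + 1) (B + e%:Z) L.
Proof.
move=> LK eB.
rewrite (@sum_ord_extend _ L.+1 K (fun r => q ^+ (r ^ 2 + e * r)%N
  * iq (L%:Z - r%:Z) * altsum A B r)) // => [|r Lr]; last first.
  by rewrite (@iq_lt0 (_ - _)) ?(mulr0, mul0r) //; lia.
case: e eB => [->|_] //.
  rewrite subrK -altsum_stepq; apply: eq_bigr => r _.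
  by rewrite exprnP; congr (q ^ _ * _ * _); lia.
rewrite addr0 -altsum_step; apply: eq_bigr => r _.
by rewrite exprnP; congr (q ^ _ * _ * _); lia.
Qed.

Lemma part_cons (f x i : nat) (ns : f.-tuple nat) :
  part (cons_tuple x ns) i.+2 = part ns i.+1.
Proof. by []. Qed.

Lemma psum_cons (f x i : nat) (ns : f.-tuple nat) :
  psum (cons_tuple x ns) i.+2 = psum ns i.+1.
Proof.
by rewrite /psum big_add1 !big_add1; apply: eq_bigr => k _.
Qed.

Lemma psum_cons1 (f x : nat) (ns : f.-tuple nat) :
  psum (cons_tuple x ns) 1 = (x + psum ns 1)%N.
Proof. by rewrite /psum big_ltn // !big_add1. Qed.

Lemma summand1 (L s m n x : nat) :
  summand q L s m n (cons_tuple x [tuple])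
  = poch (2 * L) * (q ^+ (x ^ 2 + (0 < s)%N * x)%N * iq (L%:Z - x%:Z)
    * ((poch (2 * x))^-1 * (poch x * (q ^+ (2 * m ^ 2 + 6 * m * n + 6 * n ^ 2)%N
      / (poch m * qpoch (q ^+ 3) (q ^+ 3) n)
      * iq (x%:Z - (3 * n)%N%:Z - (2 * m)%N%:Z))))).
Proof.
have px : psum (cons_tuple x [tuple]) 1 = x.
  by rewrite psum_cons1 /psum big_geq // addn0.
rewrite /summand big_nat1 px (big_geq (leqnn 1)) mul1r.
rewrite [part _ 1]/(part _ _) /=.
have -> : (\sum_(1 - s + 1 <= i < 2) psum (cons_tuple x [tuple]) i
  = (0 < s) * x)%N.
  by case: s => [|s];
    [rewrite big_geq | rewrite subSS sub0n add0n big_nat1 px mul1n].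
by rewrite -addnA exprD; ring.
Qed.

(** Prepending n_1 = x turns the old N_1 into N_2 and makes r the new N_1. In the shorter summand at
    level r, the factor 1/(q)_{r-N_2} is the required 1/(q)_x. The linear exponent reaches the new
    N_1 only if [s] exceeds the old number of parts. *)
Lemma summand_cons (L f s m n x : nat) (ns : f.+1.-tuple nat) :
  let r := (x + psum ns 1)%N in
  summand q L s m n (cons_tuple x ns)
  = poch (2 * L) * (q ^+ (r ^ 2 + (f.+1 < s)%N * r)%N * iq (L%:Z - r%:Z))
    * ((poch (2 * r))^-1 * summand q r s m n ns).
Proof.
move=> r; rewrite /summand psum_cons1 -/r part_cons.
have -> : r%:Z - (psum ns 1)%:Z = x%:Z by rewrite /r; lia.
have -> : (\sum_(1 <= i < f.+3) psum (cons_tuple x ns) i ^ 2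
  = r ^ 2 + \sum_(1 <= i < f.+2) psum ns i ^ 2)%N.
  rewrite big_ltn // psum_cons1; congr (_ + _)%N; rewrite big_add1 /=.
  by rewrite !big_add1 /=; apply: eq_bigr => i _; rewrite psum_cons.
have -> : (\sum_(f.+2 - s + 1 <= i < f.+3) psum (cons_tuple x ns) i
  = (f.+1 < s) * r + \sum_(f.+1 - s + 1 <= i < f.+2) psum ns i)%N.
  have [fs|sf] := ltnP f.+1 s.
    rewrite (_ : f.+2 - s + 1 = 1)%N; last by lia.
    rewrite (_ : f.+1 - s + 1 = 1)%N; last by lia.
    rewrite big_ltn // psum_cons1 mul1n; congr (_ + _)%N; rewrite big_add1 /=.
    by rewrite !big_add1 /=; apply: eq_bigr => i _; rewrite psum_cons.
  rewrite subSn // addSn addn1 big_add1 /= !big_add1 /=.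
  by apply: eq_bigr => i _; rewrite psum_cons.
have -> : \prod_(1 <= i < f.+2) poch (part (cons_tuple x ns) i)
  = poch x * \prod_(1 <= i < f.+1) poch (part ns i).
  by rewrite big_ltn // !big_add1.
rewrite iq_nat.
set Q := (2 * m ^ 2 + _ + _)%N; set S1 := (\sum_(1 <= i < _) _)%N.
set S2 := (\sum_(_ <= i < _) _)%N; set P := \prod_(_ <= i < _) _.
have -> : (Q + (r ^ 2 + S1) + ((f.+1 < s) * r + S2)
  = (r ^ 2 + (f.+1 < s) * r) + (Q + S1 + S2))%N by lia.
have cancel y : y = poch (2 * r) / poch (2 * r) * y.
  by rewrite divff ?mul1r ?poch_neq0.
by rewrite exprD [LHS]cancel !invfM; ring.
Qed.

Lemma sum_cons_tuple (T : finType) (f : nat) (G : f.+1.-tuple T -> F) :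
  \sum_t G t = \sum_(t : f.-tuple T) \sum_x G (cons_tuple x t).
Proof.
rewrite pair_big /= (reindex (fun p : f.-tuple T * T => cons_tuple p.2 p.1)) //=.
exists (fun t => (behead_tuple t, thead t)) => [[t x] _|t _] /=.
  by congr (_, _); apply: val_inj.
by rewrite [RHS]tuple_eta; apply: val_inj.
Qed.

Lemma sum_tuple0 (T : finType) (G : 0.-tuple T -> F) :
  \sum_t G t = G [tuple].
Proof.
rewrite (big_pred1 [tuple]) // => t.
by apply/esym/eqP/val_inj; case: t => -[].
Qed.

(** The cutoff [K] is independent of [L], so that the induction on [f] can replace [L] by any r < K
    inside the same box. *)
Definition box_sum (K L f s : nat) : F :=
  \sum_(m < K) \sum_(n < K) \sum_(t : f.-tuple 'I_K)
    summand q L s m n (map_tuple val t).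

Lemma map_cons_tuple (K f : nat) (x : 'I_K) (t : f.-tuple 'I_K) :
  map_tuple val (cons_tuple x t) = cons_tuple (val x) (map_tuple val t).
Proof. exact: val_inj. Qed.

(** Induction on the number of parts with [s] fixed. While that number is below [s], the linear
    coefficient is one less than the quadratic one, as [altsum_stepq] demands; afterwards only
    ordinary steps occur and the minimum stays at [s]. *)
Lemma box_sumE (K L f s : nat) : (L < K)%N ->
  box_sum K L f.+1 s = poch (2 * L) * altsum f.+2%:Z (minn s f.+1)%:Z L.
Proof.
elim: f L => [|f IH] L LK.
  have -> : (minn s 1)%:Z = 0 + (0 < s)%N%:Z by case: s => // s; rewrite minnSS minn0.
  rewrite -[2%:Z]/(1 + 1 : int) -(@altsum_chain K) // mulr_sumr.
  transitivity (\sum_(x < K) \sum_(m < K) \sum_(n < K)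
     summand q L s m n (cons_tuple (val x) [tuple])).
    rewrite [RHS]exchange_big; apply: eq_bigr => m _.
    rewrite [RHS]exchange_big; apply: eq_bigr => n _.
    rewrite sum_cons_tuple sum_tuple0; apply: eq_bigr => x _.
    by rewrite map_cons_tuple; congr summand; apply: val_inj.
  apply: eq_bigr => x _.
  have -> : altsum 1 0 x = (poch (2 * x))^-1 * (poch (2 * x) * altsum 1 0 x).
    by rewrite mulKf ?poch_neq0.
  rewrite altsum_base; have xK := ltn_ord x.
  pose G (m n : nat) := q ^+ (2 * m ^ 2 + 6 * m * n + 6 * n ^ 2)%N
      / (poch m * qpoch (q ^+ 3) (q ^+ 3) n)
      * iq (x%:Z - (3 * n)%N%:Z - (2 * m)%N%:Z).
  have G0 m n : (x < m)%N || (x < n)%N -> G m n = 0.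
    by move=> h; rewrite /G (@iq_lt0 (_ - _ - _)) ?mulr0 //; lia.
  rewrite -(@sum_ord_extend _ x.+1 K (fun m => \sum_(n < x.+1) G m n)) //; last first.
    by move=> m xm; rewrite big1 // => n _; rewrite G0 // xm.
  rewrite !mulr_sumr; apply: eq_bigr => m _.
  rewrite -(@sum_ord_extend _ x.+1 K (G m)) //; last first.
    by move=> n xn; rewrite G0 // xn orbT.
  by rewrite !mulr_sumr; apply: eq_bigr => n _; rewrite summand1.
have -> : (minn s f.+2)%:Z = (minn s f.+1)%:Z + (f.+1 < s)%N%:Z by lia.
have -> : f.+3%:Z = f.+2%:Z + 1 :> int by lia.
rewrite -(@altsum_chain K) //; last by lia.
transitivity (\sum_(r < K) poch (2 * L) * (q ^+ (r ^ 2 + (f.+1 < s)%N * r)%N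
    * iq (L%:Z - r%:Z)) * ((poch (2 * r))^-1 * box_sum K r f.+1 s)); last first.
  rewrite mulr_sumr; apply: eq_bigr => r _.
  by rewrite IH // mulKf ?poch_neq0 // -[LHS]mulrA.
pose G m n (t : f.+1.-tuple 'I_K) (r : nat) :=
  poch (2 * L) * (q ^+ (r ^ 2 + (f.+1 < s)%N * r)%N * iq (L%:Z - r%:Z))
  * ((poch (2 * r))^-1 * summand q r s m n (map_tuple val t)).
transitivity (\sum_(m < K) \sum_(n < K) \sum_(t : f.+1.-tuple 'I_K)
    \sum_(r < K) G m n t r); last first.
  under [RHS]eq_bigr do rewrite !mulr_sumr.
  rewrite [RHS]exchange_big; apply: eq_bigr => m _.
  under [RHS]eq_bigr do rewrite !mulr_sumr.
  rewrite [RHS]exchange_big; apply: eq_bigr => n _.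
  by under [RHS]eq_bigr do rewrite !mulr_sumr; rewrite [RHS]exchange_big.
apply: eq_bigr => m _; apply: eq_bigr => n _.
rewrite sum_cons_tuple; apply: eq_bigr => t _.
(* The sum over the first part becomes a sum over r = N_1. Values of r below N_2 or from [K] on
   contribute zero. *)
rewrite -(@sum_ord_shift _ K (psum (map_tuple val t) 1) (G m n t)); first last.
- by move=> r Kr; rewrite /G (@iq_lt0 (_ - _)) ?(mulr0, mul0r) //; lia.
- by move=> r h; rewrite /G summand_gt_psum ?mulr0.
apply: eq_bigr => x _; rewrite map_cons_tuple summand_cons /G.
by rewrite (addnC (psum _ _)).
Qed.

End QSeries.

(** * The finitely supported sum as a sum over a box *)

Lemma fsbig_inj (T : finType) (J : choiceType) (V : nmodType) (g : T -> J)
    (G : J -> V) : injective g -> (forall j, (forall t, g t <> j) -> G j = 0) ->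
  \sum_(j \in [set: J]) G j = \sum_t G (g t).
Proof.
move=> g_inj G0; rewrite (fsbigE [seq g t | t <- enum T]) //.
- by rewrite big_map big_enum_cond; apply: eq_bigl => t; rewrite in_setT.
- by rewrite map_inj_uniq ?enum_uniq.
move=> j _ jg; apply: G0 => t tj; move: jg; rewrite -tj map_f //.
by rewrite mem_enum.
Qed.

Lemma part_le_psum (f i : nat) (ns : f.-tuple nat) : (0 < i <= f)%N ->
  (part ns i <= psum ns 1)%N.
Proof.
case: i => // i fi; rewrite /psum big_add1 /= big_mkord.
have lt_if : (i < f)%N by lia.
by rewrite (bigD1 (Ordinal lt_if)) //= leq_addr.
Qed.

Lemma fsbig_summand (F : fieldType) (q : F) (L f s : nat) :
  \sum_(x \in [set: nat * nat * f.+1.-tuple nat]) summand q L s x.1.1 x.1.2 x.2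
  = box_sum q L.+1 L f.+1 s.
Proof.
pose g (y : 'I_L.+1 * 'I_L.+1 * f.+1.-tuple 'I_L.+1) :
  nat * nat * f.+1.-tuple nat := (val y.1.1, val y.1.2, map_tuple val y.2).
rewrite (@fsbig_inj _ _ _ g).
- by rewrite /box_sum pair_bigA pair_bigA; apply: eq_bigr => -[[m n] t] _.
- move=> [[m n] t] [[m' n'] t'] /= [/val_inj -> /val_inj -> e].
  by congr (_, _, _); apply/val_inj/(inj_map val_inj).
(* A nonzero term has N_1 <= L and 3n + 2m <= n_f, so every index is at most L and the point lies in
   the image of [g]. *)
move=> [[m n] ns] /= ng; apply: contrapT => nz.
have hN : (psum ns 1 <= L)%N.
  by rewrite leqNgt; apply/negP => h; apply: nz; apply: summand_gt_psum.
have hf : (3 * n + 2 * m <= part ns f.+1)%N.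
  by rewrite leqNgt; apply/negP => h; apply: nz; apply: summand_gt_part.
have hp i : (i < f.+1)%N -> (nth 0%N ns i <= L)%N.
  by move=> fi; apply: leq_trans hN; exact: (@part_le_psum _ i.+1).
have mnL : (3 * n + 2 * m <= L)%N := leq_trans hf (hp f (ltnSn f)).
have [mL nL] : (m < L.+1)%N /\ (n < L.+1)%N by lia.
apply: (ng (inord m, inord n, map_tuple inord ns)); rewrite /g /= !inordK //.
congr (_, _, _); apply: val_inj; rewrite /= -map_comp.
apply: (@eq_from_nth _ 0%N); rewrite ?size_map // => i si.
rewrite (nth_map 0%N) //= inordK // ltnS hp //.
by rewrite -(size_tuple ns).
Qed.

(** * The degenerate case q = 0 *)

Lemma psum_eq0 (f : nat) (ns : f.-tuple nat) :
  psum ns 1 = 0%N -> ns = nseq_tuple f 0%N.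
Proof.
move=> h; apply: val_inj; apply: (@eq_from_nth _ 0%N) => /=.
  by rewrite size_tuple size_nseq.
move=> i; rewrite size_tuple => fi; rewrite nth_nseq fi.
by have := @part_le_psum f i.+1 ns fi; rewrite h leqn0 => /eqP.
Qed.

Lemma part_nseq0 (f i : nat) : part (nseq_tuple f 0%N) i = 0%N.
Proof. by rewrite /part nth_nseq if_same. Qed.

Lemma psum_nseq0 (f i : nat) : psum (nseq_tuple f 0%N) i = 0%N.
Proof. by rewrite /psum big1 // => k _; exact: part_nseq0. Qed.

Lemma qpoch00 (F : fieldType) (n : nat) : qpoch (0 : F) 0 n = 1.
Proof. by rewrite /qpoch big1 // => k _; rewrite mul0r subr0. Qed.

(** The exponent law [qD] fails at 0, so this case is separate. Each side collapses to one term
    equal to 1, with all indices zero on the left and j = 0 on the right, because every other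
    exponent is nonzero. *)
Lemma theorem28_q0 (F : fieldType) (L f s : nat) : (0 < f)%N -> (s <= f)%N ->
  \sum_(x \in [set: nat * nat * f.-tuple nat])
     summand (0 : F) L s x.1.1 x.1.2 x.2
  = \sum_(i < (2 * L).+1)
      let j : int := i%:Z - L%:Z in
      (jacobi3 (j + 1))%:~R
      * 0 ^ (f.+1%:Z * j ^+ 2 - s%:Z * j)
      * qbinom (0 : F) (2 * L)%:Z (L%:Z - j).
Proof.
move=> f0 sf.
rewrite (@fsbig_inj unit _ _ (fun=> (0%N, 0%N, nseq_tuple f 0%N))); first last.
- move=> [[m n] ns] ne /=; rewrite /summand.
  set e := (X in 0 ^+ X); suff e0 : (0 < e)%N by rewrite expr0n gtn_eqF ?mul0r.
  rewrite lt0n; apply/eqP => ez; apply: (ne tt).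
  have [m0 n0] : m = 0%N /\ n = 0%N by rewrite /e in ez; split; nia.
  rewrite m0 n0; congr (_, _, _); apply/esym/psum_eq0.
  by move: ez; rewrite /e big_ltn //; nia.
- by move=> [] [].
rewrite big_const card_unit /= addr0.
have lt_L : (L < (2 * L).+1)%N by lia.
rewrite (bigD1 (Ordinal lt_L)) //= big1 ?addr0; last first.
  move=> i iL; have {iL} : i%:Z - L%:Z != 0.
    by apply: contra iL => /eqP h; apply/eqP/val_inj => /=; lia.
  move: (_ - _) => j j0; rewrite exp0rz [_ == 0]negbTE ?mulr0 ?mul0r //.
  by apply/eqP; rewrite expr2; nia.
rewrite subrr expr0n /= !mulr0 subr0 expr0z qbinomE !qpoch00.
have iq1 (n : nat) : inv_qpoch (0 : F) n%:Z = 1 by rewrite iq_nat qpoch00 invr1.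
have -> : (2 * L)%:Z - (L%:Z - 0) = L%:Z by lia.
rewrite subr0 !iq1 /jacobi3 /= /summand !psum_nseq0 !part_nseq0 subr0.
rewrite !big1 => [|i _|i _|i _]; rewrite ?psum_nseq0 ?part_nseq0 ?qpoch00 //.
rewrite (_ : (0 : F) ^+ 3 = 0) ?expr0n // !qpoch00.
have -> : 0%N%:Z - (3 * 0)%N%:Z - (2 * 0)%N%:Z = 0%N%:Z by lia.
by rewrite !iq1 !mulr1 invr1 !mulr1.
Qed.

Theorem theorem28 (F : fieldType) (q : F)
    (hq : forall k : nat, (0 < k)%N -> q ^+ k != 1)
    (L f s : nat) (hf : (0 < f)%N) (hs : (1 <= s <= f)%N) :
  \sum_(x \in [set: nat * nat * f.-tuple nat]) summand q L s x.1.1 x.1.2 x.2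
  = \sum_(i < (2 * L).+1)
      let j : int := i%:Z - L%:Z in
      (jacobi3 (j + 1))%:~R
      * q ^ (f.+1%:Z * j ^+ 2 - s%:Z * j)
      * qbinom q (2 * L)%:Z (L%:Z - j).
Proof.
have [->|q0] := eqVneq q 0; first by apply: theorem28_q0 => //; case/andP: hs.
case: f hf hs => // f _ hs.
rewrite fsbig_summand (box_sumE hq q0) //.
have -> : minn s f.+1 = s by lia.
rewrite /altsum (@zsumE _ L.+1 (2 * L).+1 L L.+1) //; first last.
- move=> j /orP[h|h].
    by rewrite (@iq_lt0 _ q (L%:Z - j)) ?(mulr0, mul0r) //; lia.
  by rewrite (@iq_lt0 _ q (L%:Z + j)) ?(mulr0, mul0r) //; lia.
- by lia.
(* Reversing the index is j |-> -j, which turns ((1 - j)/3) into ((j + 1)/3) and changes the sign of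
   s j. *)
rewrite mulr_sumr (reindex_inj rev_ord_inj); apply: eq_bigr => i _ /=.
have iL := ltn_ord i.
have -> : ((2 * L).+1 - i.+1)%N%:Z - L%:Z = - (i%:Z - L%:Z) by lia.
set j := i%:Z - L%:Z; rewrite qbinomE.
have -> : (2 * L)%:Z - (L%:Z - j) = L%:Z + j by lia.
rewrite /chi opprK (addrC 1 j).
have -> : f.+2%:Z * (- j * - j) + s%:Z * - j = f.+2%:Z * j ^+ 2 - s%:Z * j by ring.
ring.
Qed.
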